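(* For an additively idempotent commutative semiring $S$, the group $K_0(S)$ contains a free abelian group with countably infinite basis as a subgroup.
   Context: A semiring $(S,+,\cdot,0,1)$ consists of a commutative monoid $(S,+,0)$ and a monoid $(S,\cdot,1)$ such that multiplication distributes over addition on both sides and $0s=0=s0$ for all $s\in S$. It is additively idempotent if $s+s=s$ for all $s\in S$, and commutative if multiplication is commutative. A right $S$-semimodule is a commutative monoid $(M,+,0_M)$ with a unital, biadditive, associative right action of $S$ satisfying $0_Ms=0_M=m0$. A finitely generated projective right $S$-semimodule is a retract of $S^n$ for some $n$ (i.e. a semimodule $P$ with homomorphisms $f\colon S^n\to P$, $g\colon P\to S^n$ such that $f\circ g=\mathrm{id}_P$). $\mathcal{V}(S)$ is the commutative monoid of isomorphism classes $\overline{P}$ of finitely generated projective right $S$-semimodules under $\overline{P}+\overline{Q}=\overline{P\oplus Q}$, and $K_0(S)$ is its Grothendieck group, i.e. the abelian group with generators $\overline{P}\in\mathcal{V}(S)$ and relations $\overline{P\oplus Q}=\overline{P}+\overline{Q}$.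
   Formalization: The semiring S is additionally assumed nontrivial (1 ≠ 0); for the one-element semiring every semimodule is zero, so K_0(S) = 0 and the claim fails. *)

(* Defs.v *)
From HB Require Import structures.
From mathcomp Require Import all_boot all_order all_algebra.
From mathcomp Require Import boolp.
From mathcomp Require Import freeg.

Set Implicit Arguments.
Unset Strict Implicit.
Unset Printing Implicit Defensive.

Import GRing.Theory.

Local Open Scope ring_scope.
Local Open Scope quotient_scope.

(* All the structures of the library share one carrier universe.  For the
   isomorphism classes of semimodules over S to form an nmodType, the carriers
   of S and of its semimodules have to live strictly below that universe; this
   is why S is not declared directly as a pzSemiRingType, and why semimodules
   are not built on nmodType. *)
Record semiring := Semiring {
  sr_car :> Type;
  sr_class : GRing.PzSemiRing.axioms_ sr_car
}.

HB.instance Definition _ (S : semiring) :=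
  GRing.PzSemiRing.copy (sr_car S) (GRing.PzSemiRing.Pack (sr_class S)).

Record rsemimod (S : semiring) := RSemimod {
  rsm_car :> Type;
  rsm_zero : rsm_car;
  rsm_add : rsm_car -> rsm_car -> rsm_car;
  rsm_act : rsm_car -> S -> rsm_car;
  rsm_addA : associative rsm_add;
  rsm_addC : commutative rsm_add;
  rsm_add0 : left_id rsm_zero rsm_add;
  rsm_act1 : forall m, rsm_act m 1 = m;
  rsm_actA : forall m s t, rsm_act m (s * t) = rsm_act (rsm_act m s) t;
  rsm_actDl : forall m n s,
    rsm_act (rsm_add m n) s = rsm_add (rsm_act m s) (rsm_act n s);
  rsm_actDr : forall m s t,
    rsm_act m (s + t) = rsm_add (rsm_act m s) (rsm_act m t);
  rsm_act0l : forall s, rsm_act rsm_zero s = rsm_zero;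
  rsm_act0r : forall m, rsm_act m 0 = rsm_zero
}.

Section Semimodules.
Variable S : semiring.
Implicit Types M N P Q : rsemimod S.

Definition rsm_hom M N (f : M -> N) : Prop :=
  [/\ f (rsm_zero M) = rsm_zero N,
      forall m n, f (rsm_add m n) = rsm_add (f m) (f n)
    & forall m s, f (rsm_act m s) = rsm_act (f m) s].

Definition rsm_iso M N : Prop :=
  exists (f : M -> N) (g : N -> M),
    [/\ rsm_hom f, rsm_hom g, cancel f g & cancel g f].

Lemma rsm_hom_comp M N P (f : N -> P) (g : M -> N) :
  rsm_hom f -> rsm_hom g -> rsm_hom (f \o g).
Proof.
move=> [f0 fD fZ] [g0 gD gZ]; split=> [|m n|m s] /=.
- by rewrite g0.
- by rewrite gD.
- by rewrite gZ.
Qed.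

Lemma rsm_iso_refl M : rsm_iso M M.
Proof. by exists id, id; split. Qed.

Lemma rsm_iso_sym M N : rsm_iso M N -> rsm_iso N M.
Proof. by move=> [f [g [? ? ? ?]]]; exists g, f; split. Qed.

Lemma rsm_iso_trans M N P : rsm_iso M N -> rsm_iso N P -> rsm_iso M P.
Proof.
move=> [f [g [hf hg fg gf]]] [h [k [hh hk hK kK]]].
exists (h \o f), (g \o k); split; try exact: rsm_hom_comp.
- exact: can_comp.
- exact: can_comp.
Qed.

(* Coordinates are indexed by {i | i < n} because 'I_n does not live in a small
   enough universe. *)
Program Definition rsm_free n : rsemimod S :=
  @RSemimod S ({i : nat | (i < n)%N} -> S) (fun=> 0) (fun u v i => u i + v i)
    (fun v s i => v i * s) _ _ _ _ _ _ _ _ _.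
Next Obligation. by move=> u v w; apply: funext => i; rewrite addrA. Qed.
Next Obligation. by move=> u v; apply: funext => i; rewrite addrC. Qed.
Next Obligation. by move=> u; apply: funext => i; rewrite add0r. Qed.
Next Obligation. by apply: funext => i; rewrite mulr1. Qed.
Next Obligation. by apply: funext => i; rewrite mulrA. Qed.
Next Obligation. by apply: funext => i; rewrite mulrDl. Qed.
Next Obligation. by apply: funext => i; rewrite mulrDr. Qed.
Next Obligation. by apply: funext => i; rewrite mul0r. Qed.
Next Obligation. by apply: funext => i; rewrite mulr0. Qed.

Definition idx_ord n (i : {i : nat | (i < n)%N}) : 'I_n := Ordinal (valP i).
Definition ord_idx n (i : 'I_n) : {i : nat | (i < n)%N} :=
  exist _ (val i) (ltn_ord i).

Lemma ord_idxK n : cancel (@ord_idx n) (@idx_ord n).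
Proof. by move=> i; apply: val_inj. Qed.

Lemma idx_ordK n : cancel (@idx_ord n) (@ord_idx n).
Proof. by move=> i; apply: val_inj. Qed.

Program Definition rsm_sum M N : rsemimod S :=
  @RSemimod S (M * N)%type (rsm_zero M, rsm_zero N)
    (fun p q => (rsm_add p.1 q.1, rsm_add p.2 q.2))
    (fun p s => (rsm_act p.1 s, rsm_act p.2 s)) _ _ _ _ _ _ _ _ _.
Next Obligation. by move=> *; rewrite /= !rsm_addA. Qed.
Next Obligation. by move=> p q; congr pair; apply: rsm_addC. Qed.
Next Obligation. by move=> [p q]; rewrite /= !rsm_add0. Qed.
Next Obligation. by rewrite /= !rsm_act1. Qed.
Next Obligation. by rewrite /= !rsm_actA. Qed.
Next Obligation. by rewrite /= !rsm_actDl. Qed.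
Next Obligation. by rewrite /= !rsm_actDr. Qed.
Next Obligation. by rewrite /= !rsm_act0l. Qed.
Next Obligation. by rewrite /= !rsm_act0r. Qed.

Definition rsm_fgproj M : Prop :=
  exists n (f : rsm_free n -> M) (g : M -> rsm_free n),
    [/\ rsm_hom f, rsm_hom g & cancel g f].

Lemma rsm_free_fgproj n : rsm_fgproj (rsm_free n).
Proof. by exists n, id, id; split. Qed.

Lemma rsm_sum_fgproj M N : rsm_fgproj M -> rsm_fgproj N ->
  rsm_fgproj (rsm_sum M N).
Proof.
move=> [m [f [g [[f0 fD fZ] [g0 gD gZ] gK]]]].
move=> [n [h [k [[h0 hD hZ] [k0 kD kZ] kK]]]].
exists (m + n)%N,
  (fun v : rsm_free (m + n) =>
     (f (fun i => v (ord_idx (lshift n (idx_ord i)))),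
      h (fun i => v (ord_idx (rshift m (idx_ord i)))))),
  (fun p => fun i : {i : nat | (i < m + n)%N} =>
     match split (idx_ord i) with
     | inl j => g p.1 (ord_idx j) | inr j => k p.2 (ord_idx j)
     end).
split.
- split=> [|u v|u s] /=; first by rewrite -f0 -h0.
  + by rewrite -fD -hD.
  + by rewrite -fZ -hZ.
- split=> [|[a b] [c d]|[a b] s] /=; apply: funext => i; case: (split _) => j.
  + by rewrite g0.
  + by rewrite k0.
  + by rewrite gD.
  + by rewrite kD.
  + by rewrite gZ.
  + by rewrite kZ.
- move=> [a b] /=; rewrite -[in RHS](gK a) -[in RHS](kK b).
  congr (f _, h _); apply: funext => i /=; rewrite ord_idxK.
  + by rewrite -[lshift _ _]/(unsplit (inl _)) unsplitK /= idx_ordK.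
  + by rewrite -[rshift _ _]/(unsplit (inr _)) unsplitK /= idx_ordK.
Qed.

Lemma rsm_sum_iso M N P Q :
  rsm_iso M P -> rsm_iso N Q -> rsm_iso (rsm_sum M N) (rsm_sum P Q).
Proof.
move=> [f [g [[f0 fD fZ] [g0 gD gZ] fK gK]]].
move=> [h [k [[h0 hD hZ] [k0 kD kZ] hK kK]]].
exists (fun p => (f p.1, h p.2)), (fun p => (g p.1, k p.2)); split.
- by split=> *; rewrite /= ?f0 ?h0 ?fD ?hD ?fZ ?hZ.
- by split=> *; rewrite /= ?g0 ?k0 ?gD ?kD ?gZ ?kZ.
- by move=> [a b]; rewrite /= fK hK.
- by move=> [a b]; rewrite /= gK kK.
Qed.

Lemma rsm_sumA M N P :
  rsm_iso (rsm_sum M (rsm_sum N P)) (rsm_sum (rsm_sum M N) P).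
Proof.
exists (fun p => (p.1, p.2.1, p.2.2)), (fun p => (p.1.1, (p.1.2, p.2))).
by split=> [||[? []]|[[]]].
Qed.

Lemma rsm_sumC M N : rsm_iso (rsm_sum M N) (rsm_sum N M).
Proof.
by exists (fun p => (p.2, p.1)), (fun p => (p.2, p.1)); split=> [||[]|[]].
Qed.

Lemma rsm_sum0 M : rsm_iso (rsm_sum (rsm_free 0) M) M.
Proof.
exists snd, (fun m => (rsm_zero (rsm_free 0), m)); split=> //.
- by split=> [|m n|m s] //=; congr pair; apply: funext => -[].
- by move=> [u m]; congr pair; apply: funext => -[].
Qed.

Record fgproj := FgProj { fgp_mod :> rsemimod S; fgpP : rsm_fgproj fgp_mod }.

HB.instance Definition _ := gen_eqMixin fgproj.
HB.instance Definition _ := gen_choiceMixin fgproj.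

Definition fgp_equiv (P Q : fgproj) : bool := `[< rsm_iso P Q >].

Lemma fgp_equiv_class : equiv_class_of fgp_equiv.
Proof.
split=> [P|P Q|Q P R].
- by apply/asboolP; exact: rsm_iso_refl.
- by apply/asboolP/asboolP; exact: rsm_iso_sym.
- by move=> /asboolP PQ /asboolP QR; apply/asboolP; exact: rsm_iso_trans QR.
Qed.

Canonical fgp_equiv_rel := EquivRelPack fgp_equiv_class.
Canonical fgp_equiv_direct := defaultEncModRel fgp_equiv.

Definition projV := {eq_quot fgp_equiv}.
HB.instance Definition _ := Choice.on projV.
HB.instance Definition _ : EqQuotient _ fgp_equiv projV := EqQuotient.on projV.

Definition fgp_class (P : fgproj) : projV := \pi_projV P.

Lemma fgp_classP (P Q : fgproj) : fgp_class P = fgp_class Q <-> rsm_iso P Q.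
Proof. by split=> [/eqmodP/asboolP //|/asboolP PQ]; apply/eqmodP. Qed.

Definition fgp_sum (P Q : fgproj) : fgproj :=
  FgProj (rsm_sum_fgproj (fgpP P) (fgpP Q)).

Definition projV_zero : projV := fgp_class (FgProj (rsm_free_fgproj 0)).
Definition projV_add (x y : projV) : projV :=
  fgp_class (fgp_sum (repr x) (repr y)).

Lemma projV_addE (P Q : fgproj) :
  projV_add (fgp_class P) (fgp_class Q) = fgp_class (fgp_sum P Q).
Proof.
by apply/fgp_classP/rsm_sum_iso; apply/fgp_classP; rewrite /fgp_class reprK.
Qed.

Lemma projV_addA : associative projV_add.
Proof.
elim/quotW=> P; elim/quotW=> Q; elim/quotW=> R.
by rewrite -!/(fgp_class _) !projV_addE; apply/fgp_classP/rsm_sumA.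
Qed.

Lemma projV_addC : commutative projV_add.
Proof.
elim/quotW=> P; elim/quotW=> Q.
by rewrite -!/(fgp_class _) !projV_addE; apply/fgp_classP/rsm_sumC.
Qed.

Lemma projV_add0 : left_id projV_zero projV_add.
Proof.
elim/quotW=> P.
by rewrite -!/(fgp_class _) !projV_addE; apply/fgp_classP/rsm_sum0.
Qed.

HB.instance Definition _ :=
  GRing.isNmodule.Build projV projV_addA projV_addC projV_add0.

End Semimodules.

Section Grothendieck.
Variable M : nmodType.

(* The subgroup generated by the relations [a + b] = [a] + [b]. *)
Definition groth_rel : {pred {freeg M / int}} := fun x =>
  `[< forall H : {pred {freeg M / int}}, zmod_closed H ->
        (forall a b : M, << a + b >> - (<< a >> + << b >>) \in H) ->
      x \in H >].

Lemma groth_rel_closed : zmod_closed groth_rel.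
Proof.
split=> [|x y /asboolP xH /asboolP yH]; apply/asboolP=> H Hz HM.
  by case: Hz.
by case: (Hz) => _; apply; [exact: xH | exact: yH].
Qed.

HB.instance Definition _ :=
  GRing.isZmodClosed.Build {freeg M / int} groth_rel groth_rel_closed.

Definition groth := Quotient.quot groth_rel.
HB.instance Definition _ := GRing.Zmodule.on groth.

End Grothendieck.

Definition K0 (S : semiring) := groth (projV S).
HB.instance Definition _ (S : semiring) := GRing.Zmodule.on (K0 S).

(* Main.v *)
From HB Require Import structures.
Require Import Defs.
From mathcomp Require Import all_boot all_order all_algebra.
From mathcomp Require Import boolp classical_sets.
From mathcomp Require Import freeg.

(* A maximal proper ideal closed under passing to summands is prime, so S has
   a semiring morphism phi onto the Boolean semiring {0, 1}.  Through phi, each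
   finite chain {0 < ... < m} with max as addition is an S-semimodule, and the
   number of homomorphisms P -> {0 < ... < m} is finite, invariant under
   isomorphism and multiplicative in P.  The semimodule P_n of vectors
   v_0 >= ... >= v_(n-1) in S^n is a retract of S^n and has 'C(n + m, n) such
   homomorphisms.  For a prime p > n, taking m = p - n, the p-adic valuation of
   this number of homomorphisms is an additive invariant which is positive on
   P_n and zero on P_k for 0 < k < n; by triangularity the classes of
   P_1, P_2, ... are independent in K_0(S). *)

Set Implicit Arguments.
Unset Strict Implicit.
Unset Printing Implicit Defensive.

Import GRing.Theory.

Local Open Scope ring_scope.
Local Open Scope quotient_scope.

(** * Characters onto the Boolean semiring *)

Definition bool_character (S : semiring) (phi : S -> bool) : Prop :=
  [/\ phi 0 = false, phi 1 = true,
      forall s t, phi (s + t) = phi s || phi t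
    & forall s t, phi (s * t) = phi s && phi t].

(* In an additively idempotent S the third clause says that I is a lower set for
   the order a <= b <-> a + b = b. *)
Definition proper_lower_ideal (S : semiring) (I : S -> Prop) : Prop :=
  [/\ ~ I 1, forall a b, I a -> I b -> I (a + b),
      forall a b, I (a + b) -> I a & forall a s, I a -> I (a * s)].

Lemma exists_bool_character (S : semiring)
  (S_nontrivial : (1 : S) <> 0)
  (S_commutative : forall s t : S, s * t = t * s)
  (S_idempotent : forall s : S, s + s = s) :
  exists phi : S -> bool, bool_character phi.
Proof.
have zsf (a b : S) : a + b = 0 -> a = 0.
  by move=> ab0; rewrite -[RHS]ab0 -{2}[a]S_idempotent -addrA ab0 addr0.
have [A [[A1 AD Asub AM] Amax]] : exists A : S -> Prop,
    proper_lower_ideal A /\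
    forall B, (A `<` B)%classic -> ~ proper_lower_ideal B.
  apply: Zorn_bigcup => F FP Ftot; split.
  - by move=> [X FX X1]; have [] := FP X FX.
  - move=> a b [X FX Xa] [Y FY Yb].
    have [XY|YX] := Ftot X Y FX FY.
    + by exists Y => //; have [_ YD _ _] := FP Y FY; apply: YD => //; apply: XY.
    + by exists X => //; have [_ XD _ _] := FP X FX; apply: XD => //; apply: YX.
  - move=> a b [X FX Xab]; exists X => //.
    by have [_ _ Xsub _] := FP X FX; apply: Xsub Xab.
  - move=> a s [X FX Xa]; exists X => //.
    by have [_ _ _ XM] := FP X FX; apply: XM.
have A0 : A 0.
  apply: contrapT => nA0.
  have nA a : ~ A a by move=> Aa; apply: nA0; rewrite -[0](mulr0 a); apply: AM.
  apply: (Amax (fun x => x = 0)).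
    by split=> [x /nA //|h]; apply: (nA 0); apply: h.
  by split=> // [a b -> ->|a s ->]; rewrite ?addr0 ?mul0r.
have AMl a s : A a -> A (s * a) by rewrite S_commutative; apply: AM.
(* The elements below some i + a * s with i in [A] include [A] and a, and are closed under sums,
   summands and multiples. By maximality of [A], 1 is one of them. *)
have extend a : ~ A a -> exists i s y, A i /\ 1 + y = i + a * s.
  move=> nAa; apply: contrapT => no.
  apply: (Amax (fun x => exists i s y, A i /\ x + y = i + a * s)).
    split=> [x Ax|h]; first by exists x, 0, 0; rewrite mulr0.
    by apply: nAa; apply: h; exists 0, 1, 0; rewrite addr0 mulr1 add0r.
  split=> //.
  - move=> x x' [i [s [y [Ai e]]]] [i' [s' [y' [Ai' e']]]].
    exists (i + i'), (s + s'), (y + y'); split; first exact: AD.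
    by rewrite addrACA e e' mulrDr addrACA.
  - move=> x x' [i [s [y [Ai e]]]]; exists i, s, (x' + y); split=> //.
    by rewrite addrA.
  - move=> x t [i [s [y [Ai e]]]]; exists (i * t), (s * t), (y * t).
    by split; [exact: AM | rewrite -mulrDl e mulrDl mulrA].
(* Multiplying 1 <= i + a s and 1 <= j + b t puts 1 in A as soon as a b is. *)
have prime a b : A (a * b) -> A a \/ A b.
  move=> Aab; apply: contrapT => /not_orP[/extend[i [s [y [Ai e]]]]].
  move=> /extend[j [t [z [Aj e']]]]; apply: A1.
  apply: (Asub 1 (z + (y + y * z))).
  have -> : 1 + (z + (y + y * z)) = (1 + y) * (1 + z).
    by rewrite mulrDl mul1r mulrDr mulr1 addrA.
  rewrite e e' mulrDl; apply: (AD); first exact: AM.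
  rewrite mulrDr; apply: (AD); first exact: AMl.
  have -> : a * s * (b * t) = a * b * (s * t).
    by rewrite -!mulrA; congr (_ * _); rewrite !mulrA (S_commutative s).
  exact: AM.
exists (fun s => ~~ `[< A s >]); split.
- by rewrite asboolT.
- by rewrite asboolF.
- move=> s t; rewrite -negb_and; congr (~~ _); apply/asboolP/andP.
  + move=> Ast; split; apply/asboolP; apply: Asub; first exact: Ast.
    by rewrite addrC; exact: Ast.
  + by move=> [/asboolP As /asboolP At]; apply: AD.
- move=> s t; rewrite -negb_or; congr (~~ _); apply/asboolP/orP.
  + by move=> /prime[]; [left|right]; apply/asboolP.
  + by move=> [/asboolP As|/asboolP At]; [exact: AM|exact: AMl].
Qed.

(** * Independence in a Grothendieck group *)

Lemma fglift_groth_rel (M : nmodType) (g : M -> int^o) (x : {freeg M / int}) :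
  {morph g : a b / a + b} -> x \in @groth_rel M -> fglift g x = 0.
Proof.
move=> gD /asboolP xH.
suff /eqP : x \in [pred y | fglift g y == 0] by [].
(* The kernel of [fglift g] is one of the subgroups whose intersection is [groth_rel]. *)
apply: xH => [|a b].
- split=> [|y z]; rewrite !inE ?lift_is_additive.
    by rewrite -(subrr 0) lift_is_additive subrr.
  by move=> /eqP-> /eqP->; rewrite subrr.
(* [lift_is_additive] speaks of differences only, so the sum of the two generators is turned into a
   - (0 - b). *)
- rewrite inE lift_is_additive -[<<b>>]opprK -[- <<b>>]sub0r !lift_is_additive.
  rewrite -(subrr 0) lift_is_additive !liftU !scale1r gD subrr sub0r opprK.
  by rewrite subrr.
Qed.

(** The values g n (b k) form a triangular matrix with nonzero diagonal. Applying g N to a relation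
    among the b k with largest index N leaves only the coefficient at N times g N (b N), so this
    coefficient vanishes; descending on N kills the whole relation. *)
Lemma groth_free_subgroup (M : nmodType) (b : nat -> M) (g : nat -> M -> int) :
    (forall n, {morph g n : x y / x + y}) ->
    (forall n, g n (b n) != 0) -> (forall n k, (k < n)%N -> g n (b k) = 0) ->
  exists f : {additive {freeg nat / int} -> groth M}, injective f.
Proof.
move=> gD g_diag g_low.
pose l (x : {freeg nat / int}) : {freeg M / int} := fglift (fun k => <<b k>>) x.
have lB : zmod_morphism l by move=> x y; exact: lift_is_additive.
pose f x : groth M := \pi_(Quotient.quot (@groth_rel M)) (l x).
have fB : zmod_morphism f by move=> x y; rewrite /f lB raddfB.
pose F := GRing.isZmodMorphism.Build _ _ f fB.
pose fa : {additive {freeg nat / int} -> groth M} := HB.pack f F.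
exists fa; apply: raddf_inj => x fx0.
have {}fx0 : l x \in @groth_rel M.
  rewrite -[l x]subr0 Quotient.idealrBE; apply/eqP.
  by rewrite -[LHS]/(fa x) fx0 raddf0.
have key n : \sum_(k <- dom x) coeff k x * g n (b k) = 0.
  have := fglift_groth_rel (g := g n) (gD n) fx0.
  suff -> : fglift (g n : M -> int^o) (l x) =
            \sum_(k <- dom x) coeff k x * g n (b k) by [].
  pose h (y : {freeg nat / int}) : int^o := fglift (g n : M -> int^o) (l y).
  have hB : zmod_morphism h.
    by move=> y z; rewrite /h lB; exact: lift_is_additive.
  pose ha : {additive {freeg nat / int} -> int^o} :=
    HB.pack h (GRing.isZmodMorphism.Build _ _ h hB).
  rewrite -[LHS]/(ha x) -[in LHS](freeg_sumE x) raddf_sum.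
  apply: eq_bigr => k _; rewrite -[LHS]/(fglift _ (fglift _ _)).
  have -> : fglift (fun k => <<b k>>) <<coeff k x *g k>> =
      <<coeff k x *g b k>> :> {freeg M / int}.
    rewrite liftU.
    by apply/eqP/freeg_eqP => z; rewrite coeffZ !coeffU mul1r.
  exact: liftU.
have vanish N : (forall k, (N <= k)%N -> coeff k x = 0) -> x = 0.
  elim: N => [|N IH] xN.
    by apply/eqP/freeg_eqP => k; rewrite coeff0 xN.
  apply: IH => k; rewrite leq_eqVlt => /predU1P[<- {k}|/xN //].
  apply/eqP; rewrite -[_ == 0]orbF -(negPf (g_diag N)) -mulf_eq0.
  have := key N; have [xdom|/coeff_outdom->] := boolP (N \in dom x); last first.
    by rewrite mul0r.
  rewrite (bigD1_seq N) ?uniq_dom //= big1_seq => [|k /andP[kN _]].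
    by rewrite addr0 => ->.
  have [/g_low->|/xN->|kE] := ltngtP k N; rewrite ?mulr0 ?mul0r //.
  by rewrite kE eqxx in kN.
apply: (vanish (\max_(k <- dom x) k)%N.+1) => k; apply: contraTeq.
rewrite -mem_dom -ltnNge => kx; rewrite ltnS.
exact: (leq_bigmax_seq k).
Qed.

(** * Projective semimodules of decreasing vectors *)

Definition free_basis {S : semiring} n (i : 'I_n) : rsm_free S n :=
  fun j => (idx_ord j == i)%:R.

Section Antitone.
Variable S : semiring.
Hypothesis S_idempotent : forall s : S, s + s = s.

(** Sums are joins for the order of S, so this sends v to the least decreasing vector above v; it is
    the projection that makes the decreasing vectors a retract of S^n. *)
Definition upper_sum n (v : rsm_free S n) : rsm_free S n :=
  fun i => \sum_(j < n | (idx_ord i <= j)%N) v (ord_idx j).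

Lemma upper_sum_hom n : rsm_hom (@upper_sum n).
Proof.
split=> [|u v|v s]; apply: funext => i; rewrite /upper_sum /=.
- by rewrite big1.
- by rewrite big_split.
- by rewrite mulr_suml.
Qed.

Lemma sum_idempotent (I : finType) (A : pred I) (c : S) i0 :
  A i0 -> \sum_(i | A i) c = c.
Proof.
move=> Ai0; rewrite (bigD1 i0) //=.
elim/big_rec: _ => [|i x _ e]; first by rewrite addr0.
by rewrite addrA S_idempotent.
Qed.

Lemma upper_sumK n (v : rsm_free S n) : upper_sum (upper_sum v) = upper_sum v.
Proof.
apply: funext => i; rewrite /upper_sum /=.
rewrite (exchange_big_dep (fun k : 'I_n => idx_ord i <= k)%N) /=; last first.
  by move=> j k ij; apply: leq_trans.
(* Now v_k is repeated once for each j with i <= j <= k. This range contains k, so it is nonempty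
   and the repetitions collapse to a single v_k. *)
apply: eq_bigr => k ik; apply: (@sum_idempotent _ _ _ k).
by rewrite ik /= leqnn.
Qed.

(* As addition is idempotent, v is fixed by upper_sum iff v_0 >= v_1 >= ... for
   the order a <= b <-> a + b = b. *)
Definition antitone_car n : Type := {v : rsm_free S n | upper_sum v = v}.

Lemma antitone_inj n (u v : antitone_car n) : sval u = sval v -> u = v.
Proof. by case: u v => [u uP] [v vP] /= e; apply: eq_exist. Qed.

Lemma upper_sum_fix0 n : upper_sum (rsm_zero (rsm_free S n)) = rsm_zero _.
Proof. by case: (upper_sum_hom n). Qed.

Lemma upper_sum_fixD n (u v : rsm_free S n) :
  upper_sum u = u -> upper_sum v = v -> upper_sum (rsm_add u v) = rsm_add u v.
Proof. by move=> {2}<- {2}<-; case: (upper_sum_hom n). Qed.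

Lemma upper_sum_fixZ n (v : rsm_free S n) s :
  upper_sum v = v -> upper_sum (rsm_act v s) = rsm_act v s.
Proof. by move=> {2}<-; case: (upper_sum_hom n). Qed.

Program Definition antitone n : rsemimod S :=
  @RSemimod S (antitone_car n) (exist _ _ (upper_sum_fix0 n))
    (fun u v => exist _ _ (upper_sum_fixD (svalP u) (svalP v)))
    (fun v s => exist _ _ (upper_sum_fixZ s (svalP v))) _ _ _ _ _ _ _ _ _.
Next Obligation. by move=> *; apply: antitone_inj; apply: rsm_addA. Qed.
Next Obligation. by move=> *; apply: antitone_inj; apply: rsm_addC. Qed.
Next Obligation. by move=> *; apply: antitone_inj; apply: rsm_add0. Qed.
Next Obligation. by move=> *; apply: antitone_inj; apply: rsm_act1. Qed.
Next Obligation. by move=> *; apply: antitone_inj; apply: rsm_actA. Qed.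
Next Obligation. by move=> *; apply: antitone_inj; apply: rsm_actDl. Qed.
Next Obligation. by move=> *; apply: antitone_inj; apply: rsm_actDr. Qed.
Next Obligation. by move=> *; apply: antitone_inj; apply: rsm_act0l. Qed.
Next Obligation. by move=> *; apply: antitone_inj; apply: rsm_act0r. Qed.

Definition to_antitone n (v : rsm_free S n) : antitone n :=
  exist _ (upper_sum v) (upper_sumK v).

Lemma to_antitone_hom n : rsm_hom (@to_antitone n).
Proof.
have [U0 UD UZ] := upper_sum_hom n.
by split=> [|u v|v s]; apply: antitone_inj; [exact: U0|exact: UD|exact: UZ].
Qed.

Lemma sval_antitone_hom n :
  rsm_hom (fun v : antitone n => sval v : rsm_free S n).
Proof. by []. Qed.

Lemma sval_antitoneK n :
  cancel (fun v : antitone n => sval v : rsm_free S n) (@to_antitone n).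
Proof. by move=> [v vP]; apply: antitone_inj. Qed.

Lemma antitone_fgproj n : rsm_fgproj (antitone n).
Proof.
exists n, (@to_antitone n), (fun v => sval v); split.
- exact: to_antitone_hom.
- exact: sval_antitone_hom.
- exact: sval_antitoneK.
Qed.

(* The i-th step is (1, ..., 1, 0, ..., 0) with i + 1 ones. *)
Definition step n (i : 'I_n) : antitone n := to_antitone (free_basis i).

Lemma stepE n (i : 'I_n) j : sval (step i) j = (idx_ord j <= i)%N%:R.
Proof.
rewrite /= /upper_sum /free_basis; have [ji|ij] := leqP (idx_ord j) i.
  rewrite (bigD1 i) //= ord_idxK eqxx big1 ?addr0 // => k /andP[_ /negPf].
  by rewrite ord_idxK => ->.
rewrite big1 // => k jk; rewrite ord_idxK; case: eqVneq => // ki.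
by move: ij; rewrite ltnNge -ki jk.
Qed.

(** The steps form an increasing chain, so a homomorphism into {0, ..., m} takes nondecreasing
    values on them. *)
Lemma step_max n (i j : 'I_n) : (i <= j)%N ->
  rsm_add (step i) (step j) = step j.
Proof.
move=> ij; apply: antitone_inj; apply: funext => k.
rewrite -[LHS]/(sval (step i) k + sval (step j) k) !stepE.
have [ki|ik] := leqP (idx_ord k) i; last by rewrite add0r.
by rewrite (leq_trans ki ij) S_idempotent.
Qed.

Definition antitone_proj n : fgproj S := FgProj (antitone_fgproj n).

End Antitone.

(** * Homomorphisms into finite chains and their number *)

Section ChainHoms.
Variables (S : semiring) (phi : S -> bool).
Hypothesis phiP : bool_character phi.
Implicit Types P Q : rsemimod S.

(* Homomorphisms from P to the S-semimodule ({0, ..., m}, max) on which s acts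
   as 0 or the identity, according to phi s. *)
Definition chain_hom m P (h : P -> nat) : Prop :=
  [/\ h (rsm_zero P) = 0%N, forall a b, h (rsm_add a b) = maxn (h a) (h b),
      forall a s, h (rsm_act a s) = (phi s * h a)%N & forall a, (h a <= m)%N].

Lemma chain_hom_comp m P Q (h : Q -> nat) (u : P -> Q) :
  chain_hom m h -> rsm_hom u -> chain_hom m (h \o u).
Proof.
move=> [h0 hD hZ hm] [u0 uD uZ]; split=> [|a b|a s|a] /=.
- by rewrite u0.
- by rewrite uD.
- by rewrite uZ.
- exact: hm.
Qed.

(** The ambient type P -> nat is not finite, so the homomorphisms are counted through a finite type
    that indexes them without repetition. *)
Definition enum_chain_homs m P (T : finType) (F : T -> P -> nat) : Prop :=
  [/\ forall x, chain_hom m (F x), injective F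
    & forall h, chain_hom m h -> exists x, F x = h].

Lemma enum_chain_homs_leq m P Q (T T' : finType) (F : T -> P -> nat)
  (F' : T' -> Q -> nat) : enum_chain_homs m F -> enum_chain_homs m F' ->
  rsm_iso P Q -> (#|T| <= #|T'|)%N.
Proof.
move=> [Fh Finj _] [_ _ F'surj] [u [v [uh vh uK _]]].
have sel x : {y | F' y = F x \o v}.
  by apply: cid; apply: F'surj; apply: chain_hom_comp.
apply: (@leq_card _ _ (fun x => projT1 (sel x))) => x y exy.
apply: Finj; apply: funext => a; rewrite -[a]uK.
have := projT2 (sel x); rewrite exy (projT2 (sel y)) => e.
by have := congr1 (fun k => k (u a)) e.
Qed.

Lemma enum_chain_homs_card m P Q (T T' : finType) (F : T -> P -> nat)
  (F' : T' -> Q -> nat) : enum_chain_homs m F -> enum_chain_homs m F' ->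
  rsm_iso P Q -> #|T| = #|T'|.
Proof.
move=> hF hF' PQ; apply/eqP; rewrite eqn_leq.
by rewrite (enum_chain_homs_leq hF hF') // (enum_chain_homs_leq hF' hF) //;
  apply: rsm_iso_sym.
Qed.

(** A homomorphism on a direct sum amounts to its two restrictions, recombined by the addition of
    the chain, which is max. This makes the count multiplicative. *)
Lemma enum_chain_homs_sum m P Q (T T' : finType) (F : T -> P -> nat)
  (F' : T' -> Q -> nat) : enum_chain_homs m F -> enum_chain_homs m F' ->
  enum_chain_homs m
    (fun (x : T * T') (p : rsm_sum P Q) => maxn (F x.1 p.1) (F' x.2 p.2)).
Proof.
move=> [Fh Finj Fsurj] [F'h F'inj F'surj]; split.
- move=> [x y] /=; have [h0 hD hZ hm] := Fh x; have [k0 kD kZ km] := F'h y.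
  split=> [|[a b] [c d]|[a b] s|[a b]] /=.
  + by rewrite h0 k0.
  + by rewrite hD kD maxnACA.
  + by rewrite hZ kZ maxnMr.
  + by rewrite geq_max hm km.
- move=> [x y] [x' y'] /= e.
  have [x0 _ _ _] := Fh x; have [y0 _ _ _] := F'h y.
  have [x'0 _ _ _] := Fh x'; have [y'0 _ _ _] := F'h y'.
  congr pair; [apply: Finj|apply: F'inj]; apply: funext => a.
  + have := congr1 (fun k => k (a, rsm_zero Q)) e.
    by rewrite /= y0 y'0 !maxn0.
  + have := congr1 (fun k => k (rsm_zero P, a)) e.
    by rewrite /= x0 x'0 !max0n.
- move=> h hh; have [_ hD _ _] := hh.
  have zP : rsm_hom (fun a : P => (a, rsm_zero Q) : rsm_sum P Q).
    by split=> // *; congr pair; rewrite ?rsm_add0 ?rsm_act0l.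
  have zQ : rsm_hom (fun b : Q => (rsm_zero P, b) : rsm_sum P Q).
    by split=> // *; congr pair; rewrite ?rsm_add0 ?rsm_act0l.
  have [x xE] := Fsurj _ (chain_hom_comp hh zP).
  have [y yE] := F'surj _ (chain_hom_comp hh zQ).
  exists (x, y); apply: funext => -[a b] /=; rewrite xE yE /= -hD /=.
  by congr (h (_, _)); rewrite ?rsm_add0 // rsm_addC rsm_add0.
Qed.

Lemma chain_hom_free m n (h : rsm_free S n -> nat) (v : rsm_free S n) :
  chain_hom m h ->
  h v = \max_(i < n) (phi (v (ord_idx i)) * h (free_basis i))%N.
Proof.
move=> [h0 hD hZ _].
have vE : v = fun j => \sum_(i < n) free_basis i j * v (ord_idx i).
  apply: funext => j; rewrite (bigD1 (idx_ord j)) //= /free_basis eqxx mul1r.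
  rewrite idx_ordK big1 ?addr0 // => i; rewrite eq_sym => /negPf->.
  by rewrite mul0r.
rewrite {1}vE; elim: (index_enum _) => [|i r IH].
  rewrite big_nil -h0; congr (h _); apply: funext => j; exact: big_nil.
rewrite big_cons -IH -hZ -hD; congr (h _).
by apply: funext => j; rewrite big_cons.
Qed.

(** The images of the basis of S^n generate P, so h is determined by n values, each at most m;
    finiteness of the count rests on this. *)
Lemma chain_hom_retract m n P (f : rsm_free S n -> P) (g : P -> rsm_free S n) h
    (p : P) : rsm_hom f -> cancel g f -> chain_hom m h ->
  h p = \max_(i < n) (phi (g p (ord_idx i)) * h (f (free_basis i)))%N.
Proof.
move=> fh gK hh; rewrite -{1}[p]gK.
exact: (chain_hom_free (g p) (chain_hom_comp hh fh)).
Qed.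

Lemma exists_enum_chain_homs m P : rsm_fgproj P ->
  exists (T : finType) (F : T -> P -> nat), enum_chain_homs m F.
Proof.
move=> [n [f [g [fh _ gK]]]].
pose F (x : {ffun 'I_n -> 'I_m.+1}) p :=
  \max_(i < n) (phi (g p (ord_idx i)) * x i)%N.
(* A table x of values need not define a homomorphism, and several tables may define the same one
   when P is not free. The second condition keeps only the table of the values actually taken at the
   generators. *)
pose good x := `[< chain_hom m (F x) >] &&
  [forall i, F x (f (free_basis i)) == x i].
exists {x | good x}, (fun x => F (val x)); split.
- by move=> [x /=] /andP[/asboolP].
- move=> [x /= gx] [y /= gy] e; apply: val_inj => /=; apply/ffunP => i.
  have /andP[_ /forallP/(_ i)/eqP xi] := gx.
  have /andP[_ /forallP/(_ i)/eqP yi] := gy.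
  by apply: val_inj; rewrite /= -xi -yi e.
- move=> h hh; have [_ _ _ hm] := hh.
  pose x := [ffun i => inord (h (f (free_basis i)))] : {ffun 'I_n -> 'I_m.+1}.
  have xE i : x i = h (f (free_basis i)) :> nat by rewrite ffunE inordK // ltnS.
  have FxE : F x = h.
    apply: funext => p; rewrite (chain_hom_retract p fh gK hh).
    by apply: eq_bigr => i _; rewrite xE.
  have gx : good x.
    by rewrite /good FxE asboolT //=; apply/forallP => i; rewrite xE.
  by exists (Sub x gx).
Qed.

Lemma chain_hom_count_ex m (P : fgproj S) :
  exists k (T : finType) (F : T -> P -> nat), enum_chain_homs m F /\ #|T| = k.
Proof.
have [T [F FP]] := exists_enum_chain_homs m (fgpP P).
by exists #|T|, T, F.
Qed.

Definition chain_hom_count m (P : fgproj S) : nat :=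
  projT1 (cid (chain_hom_count_ex m P)).

Lemma chain_hom_countE m (P : fgproj S) (Q : rsemimod S) (T : finType)
    (F : T -> Q -> nat) :
  rsm_iso P Q -> enum_chain_homs m F -> chain_hom_count m P = #|T|.
Proof.
rewrite /chain_hom_count; case: cid => k /= [T' [F' [F'P <-]]] PQ FP.
exact: (enum_chain_homs_card F'P FP PQ).
Qed.

Lemma chain_hom_count_iso m (P Q : fgproj S) :
  rsm_iso P Q -> chain_hom_count m P = chain_hom_count m Q.
Proof.
have [k [T [F [FQ _]]]] := chain_hom_count_ex m Q => PQ.
by rewrite (chain_hom_countE PQ FQ) (chain_hom_countE (rsm_iso_refl Q) FQ).
Qed.

Lemma chain_hom_count_sum m (P Q : fgproj S) :
  chain_hom_count m (fgp_sum P Q) =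
  (chain_hom_count m P * chain_hom_count m Q)%N.
Proof.
have [k [T [F [FP _]]]] := chain_hom_count_ex m P.
have [k' [T' [F' [FQ _]]]] := chain_hom_count_ex m Q.
rewrite (chain_hom_countE (rsm_iso_refl P) FP).
rewrite (chain_hom_countE (rsm_iso_refl Q) FQ) -card_prod.
exact: (chain_hom_countE (P := fgp_sum P Q) (rsm_iso_refl _)
  (enum_chain_homs_sum FP FQ)).
Qed.

(** The zero map is always counted. Positivity lets [logn] turn the product of counts into a sum. *)
Lemma chain_hom_count_gt0 m (P : fgproj S) : (0 < chain_hom_count m P)%N.
Proof.
have [k [T [F [FP _]]]] := chain_hom_count_ex m P.
rewrite (chain_hom_countE (rsm_iso_refl P) FP).
have [_ _ /(_ (fun=> 0%N))[|x _]] := FP; last by apply/card_gt0P; exists x.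
by split=> // a s; rewrite muln0.
Qed.

Lemma chain_hom_maxsum m n (P : rsemimod S) (g : P -> rsm_free S n)
    (t : 'I_n -> nat) : rsm_hom g -> (forall i, (t i <= m)%N) ->
  chain_hom m (fun v : P => \max_(i < n) (phi (g v (ord_idx i)) * t i)%N).
Proof.
move=> [g0 gD gZ] tm; have [phi0 _ phiD phiM] := phiP; split.
- by rewrite big1 // => i _; rewrite g0 phi0.
- move=> a b; rewrite -big_split; apply: eq_bigr => i _ /=.
  by rewrite gD phiD -maxnMl; case: (phi _); case: (phi _).
- move=> a s; have [ps|ps] := boolP (phi s); last first.
    by rewrite mul0n big1 // => i _; rewrite gZ phiM (negPf ps) andbF.
  by rewrite mul1n; apply: eq_bigr => i _; rewrite gZ phiM ps andbT.
- move=> a; apply/bigmax_leqP => i _.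
  by case: (phi _); rewrite ?mul1n ?mul0n.
Qed.

Definition chain_logn p m (x : projV S) : int :=
  (logn p (chain_hom_count m (repr x)))%:Z.

Lemma chain_lognE p m (P : fgproj S) :
  chain_logn p m (fgp_class P) = (logn p (chain_hom_count m P))%:Z.
Proof.
congr (Posz (logn p _)); apply: chain_hom_count_iso; apply/fgp_classP.
by rewrite /fgp_class reprK.
Qed.

Lemma chain_lognD p m : {morph chain_logn p m : x y / x + y}.
Proof.
move=> x y; rewrite -[LHS]/(chain_logn p m (fgp_class _)) chain_lognE.
by rewrite chain_hom_count_sum lognM ?chain_hom_count_gt0.
Qed.

(** * Counting the homomorphisms on decreasing vectors *)

Hypothesis S_idempotent : forall s : S, s + s = s.

Lemma max_step n (t : 'I_n -> nat) (i : 'I_n) :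
  {homo t : i j / (i <= j)%N} ->
  \max_(j < n) (phi (sval (step S_idempotent i) (ord_idx j)) * t j)%N = t i.
Proof.
move=> tmono; have [phi0 phi1 _ _] := phiP.
apply/eqP; rewrite eqn_leq; apply/andP; split.
  apply/bigmax_leqP => j _; rewrite stepE ord_idxK.
  by have [ji|_] := leqP j i; rewrite ?phi1 ?phi0 ?mul1n ?mul0n // tmono.
set F := (F in \max_(j < n) F j); apply: leq_trans (leq_bigmax_cond i isT).
by rewrite /F stepE ord_idxK leqnn phi1 mul1n.
Qed.

Lemma sorted_tupleP m n (t : n.-tuple 'I_m) :
  reflect {homo (fun i => tnth t i : nat) : i j / (i <= j)%N}
          (sorted leq (map val t)).
Proof.
have tE (i : 'I_n) : tnth t i = nth 0%N (map val t) i :> nat.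
  by rewrite (nth_map (tnth t i)) ?size_tuple // -tnth_nth.
apply: (iffP idP) => [st i j ij|tmono].
  rewrite !tE; apply: (sorted_leq_nth leq_trans leqnn) => //;
    by rewrite inE size_map size_tuple.
apply/(sortedP 0%N) => i; rewrite size_map size_tuple => iSn.
have := tmono (Ordinal (ltnW iSn)) (Ordinal iSn); rewrite !tE; apply.
exact: leqnSn.
Qed.

Definition antitone_chain_hom m n
    (t : {t : n.-tuple 'I_m.+1 | sorted leq (map val t)})
    (v : antitone S n) : nat :=
  \max_(i < n) (phi (sval v (ord_idx i)) * tnth (val t) i)%N.

(** The retraction sends the basis of S^n to the steps, so a homomorphism is determined by its
    values there. These form a nondecreasing sequence, and [max_step] shows that every nondecreasing
    sequence in {0, ..., m} arises. *)
Lemma antitone_chain_homP m n : enum_chain_homs m (@antitone_chain_hom m n).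
Proof.
split.
- move=> t; apply: chain_hom_maxsum; first exact: sval_antitone_hom.
  by move=> i; rewrite -ltnS.
- move=> [t tP] [u uP] e; apply: val_inj; apply: eq_from_tnth => i /=.
  apply: val_inj; have := congr1 (fun k => k (step S_idempotent i)) e.
  by rewrite /antitone_chain_hom !max_step //; apply/sorted_tupleP.
- move=> h hh; have [_ hD _ hm] := hh.
  pose t := [tuple inord (h (step S_idempotent i)) : 'I_m.+1 | i < n].
  have tE i : tnth t i = h (step S_idempotent i) :> nat.
    by rewrite tnth_mktuple inordK // ltnS.
  have tP : sorted leq (map val t).
    apply/sorted_tupleP => i j ij.
    by rewrite !tE -[step _ j](step_max S_idempotent ij) hD leq_maxl.
  exists (Sub t tP); apply: funext => v.
  rewrite (chain_hom_retract v (@to_antitone_hom _ S_idempotent n)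
    (@sval_antitoneK _ S_idempotent n) hh).
  by apply: eq_bigr => i _; rewrite SubK tE.
Qed.

Lemma chain_hom_count_antitone m n :
  chain_hom_count m (antitone_proj S_idempotent n) = 'C(n + m, n).
Proof.
rewrite (chain_hom_countE (P := antitone_proj S_idempotent n) (rsm_iso_refl _)
  (@antitone_chain_homP m n)).
by rewrite card_sig -card_sorted_tuples cardsE.
Qed.

End ChainHoms.

(** * Valuations of binomial coefficients and the conclusion *)

Lemma logn_bin_small p n k : prime p -> (n < p)%N -> logn p 'C(n, k) = 0%N.
Proof.
(* For k > n the binomial is 0, whose [logn] is 0 by convention; otherwise it divides n!, all of
   whose factors are less than p. *)
move=> p_prime np; have [kn|/bin_small->] := leqP k n; last by rewrite logn0.
apply/eqP; rewrite -leqn0; apply: (@leq_trans (logn p n`!)).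
  by apply: dvdn_leq_log; rewrite ?fact_gt0 // -(bin_fact kn) dvdn_mulr.
rewrite logn_fact // big_nat big1 // => i /andP[i0 _]; apply: divn_small.
by apply: (leq_trans np); rewrite -{1}(expn1 p) leq_exp2l ?prime_gt1.
Qed.

Theorem proposition6p7 (S : semiring)
  (S_nontrivial : (1 : S) <> 0)
  (S_commutative : forall s t : S, s * t = t * s)
  (S_idempotent : forall s : S, s + s = s) :
  exists f : {additive {freeg nat / int} -> K0 S}, injective f.
Proof.
have [phi phiP] :=
  exists_bool_character S_nontrivial S_commutative S_idempotent.
have [q q_prime q_gt] :
    exists2 q, forall n, prime (q n) & forall n, (n.+1 < q n)%N.
  by exists (fun n => s2val (prime_above n.+1)) => n; case: prime_above.
(* The index n stands for vectors of length n + 1, as those of length 0 form the zero semimodule. *)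
apply: (groth_free_subgroup
  (b := fun n => fgp_class (antitone_proj S_idempotent n.+1))
  (g := fun n => chain_logn phi (q n) (q n - n.+1))) => [n|n|n k kn].
- exact: chain_lognD.
(* The count is 'C(q n, n + 1), divisible by the prime q n because 0 < n + 1 < q n. *)
- rewrite chain_lognE chain_hom_count_antitone // subnKC ?(ltnW (q_gt n)) //.
  rewrite -[_ == 0]/(logn _ _ == 0%N) -lt0n logn_gt0 mem_primes q_prime.
  by rewrite bin_gt0 ltnW ?prime_dvd_bin // q_gt.
(* The upper index of the binomial is (k + 1) + (q n - (n + 1)), which is less than q n since k <
   n. *)
- rewrite chain_lognE chain_hom_count_antitone // logn_bin_small //.
  rewrite addnBA ?(ltnW (q_gt n)) //.
  by rewrite ltn_subLR ?ltn_add2r // ltnW // ltn_addl.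
Qed.
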